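(* Let $(U,\varphi)$ be a finite standard closure space and $x\in U$. For every $C\in\{\varphi(B): B \text{ an } E\text{-generator of } x\}$ there exist a pseudo-closed set $P$ (so that $P\to C\setminus P$ belongs to the canonical base) and an $E$-generator $A$ of $x$ such that $A\subseteq P$, $x\notin P$, and $\varphi(A)=\varphi(P)=C$.
   Context: $(U,\varphi)$: finite set with closure operator; standard: $\varphi(\{x\})\setminus\{x\}$ closed for all $x$. Quasi-closed $Q$: for all $X\subseteq Q$ with $\varphi(X)\subsetneq\varphi(Q)$, $\varphi(X)\subseteq Q$. Pseudo-closed $P$: not closed and inclusion-minimal among quasi-closed $Q$ with $\varphi(Q)=\varphi(P)$. Canonical (Duquenne–Guigues) base: $\{P\to\varphi(P)\setminus P: P \text{ pseudo-closed}\}$. $\varphi^b(X)=\bigcup_{y\in X}\varphi(\{y\})$. $D$-generator of $x$: $A$ with $x\in\varphi(A)$, $x\notin\varphi^b(A)$, and $x\notin\varphi(B)$ whenever $\varphi^b(B)\subsetneq\varphi^b(A)$. $E$-generator of $x$: a $D$-generator $A$ with $\varphi(A)$ inclusion-minimal among closures of $D$-generators of $x$. *)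

(* Defs.v *)
From mathcomp Require Export all_boot.

Set Implicit Arguments.
Unset Strict Implicit.
Unset Printing Implicit Defensive.

Section ClosureSpace.

Variable U : finType.

Implicit Types (phi : {set U} -> {set U}) (x : U).

Definition closure_operator phi : Prop :=
  [/\ forall X : {set U}, X \subset phi X,
      forall X Y : {set U}, X \subset Y -> phi X \subset phi Y
    & forall X : {set U}, phi (phi X) = phi X].

Definition closed_set phi (X : {set U}) : bool := phi X == X.

Definition standard phi : Prop :=
  forall x, closed_set phi (phi [set x] :\ x).

Definition quasi_closed phi (Q : {set U}) : bool :=
  [forall X : {set U}, (X \subset Q) && (phi X \proper phi Q) ==>
                       (phi X \subset Q)].

Definition pseudo_closed phi (P : {set U}) : bool :=
  ~~ closed_set phi P &&
  minset [pred Q : {set U} | quasi_closed phi Q && (phi Q == phi P)] P.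

(* An implication P -> C is encoded as the pair (P, C). *)
Definition canonical_base phi : {set {set U} * {set U}} :=
  [set (P, phi P :\: P) | P : {set U} & pseudo_closed phi P].

Definition phib phi (X : {set U}) : {set U} :=
  \bigcup_(y in X) phi [set y].

Definition D_generator phi x (A : {set U}) : bool :=
  [&& x \in phi A, x \notin phib phi A
    & [forall B : {set U}, (phib phi B \proper phib phi A) ==>
                           (x \notin phi B)]].

Definition E_generator phi x (A : {set U}) : bool :=
  D_generator phi x A &&
  minset [in [set phi B | B : {set U} & D_generator phi x B]] (phi A).

Definition E_closures phi x : {set {set U}} :=
  [set phi B | B : {set U} & E_generator phi x B].

End ClosureSpace.

(* Main.v *)
Require Import Defs.
From mathcomp Require Import all_boot.

(** Let [C = phi B] for an E-generator [B] of [x]. If [X] lies in a set [S] that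
    omits [x] and is closed under [phib], and [phi X] is a proper subset of [C],
    then [x \notin phi X]: otherwise [X] would contain, up to [phib], a
    D-generator of [x] whose closure is strictly below [C]. So a maximal such
    [S] between [B] and [C] absorbs these [phi X], that is, it is quasi-closed.
    A minimal quasi-closed [P] inside [S] with [phi P = C] is pseudo-closed and
    still closed under [phib]; since [x \in phi P], it contains a D-generator of
    [x], whose closure is [C] by minimality. *)

Section ClosureOperatorTheory.

Set Implicit Arguments.
Unset Strict Implicit.

Variables (U : finType) (phi : {set U} -> {set U}).
Hypothesis phi_closure : closure_operator phi.

Implicit Types (x y : U) (A B C P S X Y : {set U}).

Lemma sub_phi X : X \subset phi X.
Proof. by case: phi_closure. Qed.

Lemma phiS X Y : X \subset Y -> phi X \subset phi Y.
Proof. by case: phi_closure => _ + _; apply. Qed.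

Lemma phi_idem X : phi (phi X) = phi X.
Proof. by case: phi_closure. Qed.

Lemma phi_sub_phi X Y : X \subset phi Y -> phi X \subset phi Y.
Proof. by move=> /phiS; rewrite phi_idem. Qed.

Lemma phi1_sub_phi y Y : y \in phi Y -> phi [set y] \subset phi Y.
Proof. by move=> yY; apply: phi_sub_phi; rewrite sub1set. Qed.

Lemma sub_phib X : X \subset phib phi X.
Proof.
apply/subsetP => y yX; apply/bigcupP; exists y => //.
by apply: (subsetP (sub_phi _)); rewrite set11.
Qed.

Lemma phib_sub_phi X : phib phi X \subset phi X.
Proof. by apply/bigcupsP => y yX; apply: phiS; rewrite sub1set. Qed.

Lemma phibS X Y : X \subset Y -> phib phi X \subset phib phi Y.
Proof.
move=> sXY; apply/bigcupsP => y yX.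
exact: (bigcup_sup y (subsetP sXY y yX)).
Qed.

Lemma phibU X Y : phib phi (X :|: Y) = phib phi X :|: phib phi Y.
Proof. exact: bigcup_setU. Qed.

Lemma phib_phi X : phib phi (phi X) = phi X.
Proof.
by apply/eqP; rewrite eqEsubset sub_phib -{2}[phi X]phi_idem phib_sub_phi.
Qed.

Lemma phib_idem X : phib phi (phib phi X) = phib phi X.
Proof.
apply/eqP; rewrite eqEsubset sub_phib andbT.
apply/bigcupsP => y /bigcupP[z zX yz].
exact: subset_trans (phi1_sub_phi yz) (bigcup_sup z zX).
Qed.

Lemma phi_sub_of_phib X Y : phib phi X \subset phib phi Y -> phi X \subset phi Y.
Proof.
move=> sXY; apply: phi_sub_phi.
exact: subset_trans (sub_phib X) (subset_trans sXY (phib_sub_phi Y)).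
Qed.

(** Among the sets [A] with [x \in phi A] and [phib phi A] inside [phib phi X], one with the fewest
    elements in [phib phi A] works: a rival with strictly smaller [phib] would be a smaller
    candidate. *)
Lemma exists_D_generator x X : x \in phi X -> x \notin phib phi X ->
  exists2 A, D_generator phi x A & phib phi A \subset phib phi X.
Proof.
move=> xX xbX.
pose gen A := (x \in phi A) && (phib phi A \subset phib phi X).
have genX : gen X by rewrite /gen xX subxx.
case: (arg_minnP (fun A => #|phib phi A|) genX) => A /andP[xA sAX] minA.
exists A => //; apply/and3P; split=> //; first exact: contra (subsetP sAX x) xbX.
apply/forallP => B; apply/implyP => ltBA; apply/negP => xB.
have /minA : gen B by rewrite /gen xB (subset_trans (proper_sub ltBA) sAX).
by rewrite leqNgt (proper_card ltBA).
Qed.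

Lemma E_generator_phi_min x A B : E_generator phi x A -> D_generator phi x B ->
  phi B \subset phi A -> phi B = phi A.
Proof.
move=> /andP[_ /minsetP[_ minA]] genB; apply: minA.
by apply: imset_f; rewrite inE.
Qed.

Lemma E_generator_phi_eq x A B : E_generator phi x A -> D_generator phi x B ->
  phi B = phi A -> E_generator phi x B.
Proof. by move=> /andP[_ minA] genB eqBA; rewrite /E_generator genB eqBA. Qed.

Lemma notin_phi_proper_E_generator x B X : E_generator phi x B ->
  x \notin phib phi X -> phi X \proper phi B -> x \notin phi X.
Proof.
move=> genB xbX ltXB; apply/negP => xX.
have [A genA /phi_sub_of_phib sAX] := exists_D_generator xX xbX.
have := E_generator_phi_min genB genA (subset_trans sAX (proper_sub ltXB)).
by move=> eqAB; move: ltXB; rewrite -eqAB properE sAX andbF.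
Qed.

Lemma exists_quasi_closed x B : E_generator phi x B ->
  exists S, [/\ quasi_closed phi S, phi S = phi B, x \notin S
              & phib phi S \subset S].
Proof.
move=> genB; have /andP[/and3P[_ xbB _] _] := genB.
pose good := [pred S : {set U} | [&& B \subset S, S \subset phi B, x \notin S
                                   & phib phi S \subset S]].
(* [B] itself may not be closed under [phib], so the search for a maximal set starts from
   [phib phi B]. *)
have goodB : good (phib phi B).
  by rewrite /= sub_phib phib_sub_phi xbB phib_idem subxx.
have [S /maxsetP[/and4P[sBS sSB xS bS] maxS] _] := maxset_exists goodB.
have eqSB : phi S = phi B by apply/eqP; rewrite eqEsubset phi_sub_phi // phiS.
exists S; split=> //; apply/forallP => X; apply/implyP => /andP[sXS].
rewrite eqSB => ltXB.
have xX : x \notin phi X.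
  apply: notin_phi_proper_E_generator genB _ ltXB.
  exact: contra (subsetP (subset_trans (phibS sXS) bS) x) xS.
(* By maximality it is enough that [S :|: phi X] is still good. It omits [x] by [xX], and it stays
   closed under [phib] because [phib] distributes over unions and fixes [phi X]. *)
suff <- : S :|: phi X = S by apply: subsetUr.
apply: maxS; last exact: subsetUl.
rewrite /= (subset_trans sBS (subsetUl _ _)) subUset sSB (proper_sub ltXB).
by rewrite inE negb_or xS xX phibU phib_phi setSU.
Qed.

Lemma exists_pseudo_closed x S : quasi_closed phi S -> x \in phi S ->
  x \notin S -> exists P, [/\ pseudo_closed phi P, P \subset S & phi P = phi S].
Proof.
move=> qS xphiS xS.
have qcS : [pred Q | quasi_closed phi Q && (phi Q == phi S)] S.
  by rewrite /= qS eqxx.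
have [P minP sPS] := minset_exists qcS.
have /minsetP[/andP[_ /eqP eqPS] _] := minP.
exists P; split=> //; rewrite /pseudo_closed eqPS minP andbT.
(* A closed [P] would equal [phi S], and so would bring [x] into [S]. *)
apply: contra xS => /eqP closedP; apply: (subsetP sPS).
by rewrite -closedP eqPS.
Qed.

End ClosureOperatorTheory.

Theorem theorem9 (U : finType) (phi : {set U} -> {set U})
  (phi_closure : closure_operator phi) (phi_standard : standard phi)
  (x : U) (C : {set U}) (hC : C \in E_closures phi x) :
  exists P A : {set U},
    [/\ pseudo_closed phi P, (P, C :\: P) \in canonical_base phi
      & E_generator phi x A] /\
    [/\ A \subset P, x \notin P, phi A = C & phi P = C].
Proof.
case/imsetP: hC => B; rewrite inE => genB ->{C}.
have xB : x \in phi B by case/andP: genB => /and3P[].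
have [S [qS eqSB xS bS]] := exists_quasi_closed phi_closure genB.
have xphiS : x \in phi S by rewrite eqSB.
have [P [psP sPS eqPS]] := exists_pseudo_closed qS xphiS xS.
have eqPB : phi P = phi B by rewrite eqPS.
have xP : x \notin P by apply: contra xS; apply: (subsetP sPS).
(* For [y] in [P], quasi-closedness puts [phi [set y]] inside [P] once it is a proper subset of
   [phi P]. Otherwise it would be all of [phi P], hence contain [x], and [x] would lie in
   [phib phi S], thus in [S]. *)
have bP : phib phi P \subset P.
  have /andP[_ /minsetP[/andP[/forallP qP _] _]] := psP.
  apply/bigcupsP => y yP; apply: (implyP (qP [set y])).
  rewrite sub1set yP properE phiS ?sub1set //=; apply: contra xS => sPy.
  apply: (subsetP bS); apply/bigcupP; exists y; first exact: (subsetP sPS).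
  by apply: (subsetP sPy); rewrite eqPB.
have xphiP : x \in phi P by rewrite eqPB.
have xbP : x \notin phib phi P by apply: contra xP; apply: (subsetP bP).
have [A genA sAP] := exists_D_generator xphiP xbP.
(* The inclusion of [phib phi A] in [phib phi P] gives [phi A] inside [phi P], which is [phi B];
   minimality of [phi B] forces equality. *)
have eqAB : phi A = phi B.
  by apply: E_generator_phi_min genB genA _; rewrite -eqPB phi_sub_of_phib.
exists P, A; split; split=> //.
- by rewrite -eqPB; apply: (imset_f (fun Q => (Q, phi Q :\: Q))); rewrite inE.
- exact: E_generator_phi_eq genB genA eqAB.
- exact: subset_trans (sub_phib phi_closure A) (subset_trans sAP bP).
Qed.
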